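(* Suppose Assumptions 1-3 of the context hold. Consider the optimization problem, over $z\in\mathbb R$ and $\boldsymbol r=(r_{h\ell})_{h\le k,\ell\le q}$, $$\max\ z\quad\text{s.t.}\quad \mathcal R_{ij}^\ell(r_{\langle i\rangle\ell},r_{\langle j\rangle\ell})-z\ge0\ \ (i=1,\dots,m,\ j=m+1,\dots,k,\ \ell=1,\dots,q),\quad \sum_{h=1}^k\sum_{\ell=1}^q r_{\langle h\rangle\ell}=1,\quad r_{\langle h\rangle\ell}\ge0 .$$ Then the optimal solution, with asymptotically optimal sampling ratios $r^*_{h\ell}$, satisfies $r^*_{h\ell}>0$ for $h=1,\dots,k$, $\ell=1,\dots,q$, and for all $i,i'=1,\dots,m$, $j,j'=m+1,\dots,k$, $\ell,\ell'=1,\dots,q$, $$\min_{j=m+1,\dots,k}\mathcal R_{ij}^\ell(r^*_{\langle i\rangle\ell},r^*_{\langle j\rangle\ell})=\min_{i'=1,\dots,m}\mathcal R_{i'j'}^\ell(r^*_{\langle i'\rangle\ell},r^*_{\langle j'\rangle\ell})=\min_{j=m+1,\dots,k}\mathcal R_{ij}^{\ell'}(r^*_{\langle i\rangle\ell'},r^*_{\langle j\rangle\ell'})=\min_{i'=1,\dots,m}\mathcal R_{i'j'}^{\ell'}(r^*_{\langle i'\rangle\ell'},r^*_{\langle j'\rangle\ell'})$$ (in the first and third terms $i$ is free and the minimum is over $j$; in the second and fourth $j'$ is free and the minimum is over $i'$).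
   Context: Setting. There are $k$ designs, $q$ contexts $\boldsymbol x_1,\dots,\boldsymbol x_q$, and an integer $1\le m<k$. Replications of each design-context pair $(h,\ell)$ are i.i.d. with mean $y_h(\boldsymbol x_\ell)$ (from a general distribution), independent across pairs. For each $\ell$, designs are ranked by true means: $y_{\langle1\rangle_\ell}(\boldsymbol x_\ell)\ge\dots\ge y_{\langle m\rangle_\ell}(\boldsymbol x_\ell)>y_{\langle m+1\rangle_\ell}(\boldsymbol x_\ell)\ge\dots\ge y_{\langle k\rangle_\ell}(\boldsymbol x_\ell)$. A subscript $\langle h\rangle\ell$ refers to the pair (design $\langle h\rangle_\ell$, context $\ell$). The number $r_{h\ell}\ge0$ is the fraction of the total simulation budget allocated to pair $(h,\ell)$. Let $\bar Y_{h\ell}(n)$ be the mean of $n$ replications, $\Lambda_{h\ell}(\lambda)=\lim_{n\to\infty}\frac1n\log\mathbb E\exp(n\lambda\bar Y_{h\ell}(n))$ (for i.i.d. replications this is the log moment generating function of one replication), $\mathcal D_{h\ell}=\{\lambda\in\mathbb R:\Lambda_{h\ell}(\lambda)<\infty\}$, $\mathcal F_{h\ell}=\{\Lambda_{h\ell}'(\lambda):\lambda\in\mathcal D_{h\ell}^o\}$, with $^o$ denoting interior, and $\Lambda^*_{h\ell}(x)=\sup_{\lambda\in\mathbb R}\{\lambda x-\Lambda_{h\ell}(\lambda)\}$. Assumption 1: $\Lambda_{h\ell}(\lambda)$ is well defined as an extended real number for all $\lambda$, and $0\in\mathcal D_{h\ell}^o$, for all $h,\ell$. Assumption 2: $\Lambda_{h\ell}$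 is strictly convex and continuous on $\mathcal D_{h\ell}^o$ and steep, i.e. $|\Lambda_{h\ell}'(\lambda_n)|\to\infty$ for any sequence $\lambda_n$ converging to a boundary point of $\mathcal D_{h\ell}^o$, for all $h,\ell$. Assumption 3: $[y_{\langle k\rangle_\ell}(\boldsymbol x_\ell),y_{\langle1\rangle_\ell}(\boldsymbol x_\ell)]\subset\bigcap_{i=1}^k\mathcal F_{i\ell}^o$ for all $\ell$. Rate functions. For $i\le m<j$ and $a,b>0$, $\mathcal R_{ij}^\ell(a,b)=a\Lambda^*_{\langle i\rangle\ell}(x)+b\Lambda^*_{\langle j\rangle\ell}(x)$, where $x=x(a,b)$ is the unique solution of $a\frac{d}{dx}\Lambda^*_{\langle i\rangle\ell}(x)+b\frac{d}{dx}\Lambda^*_{\langle j\rangle\ell}(x)=0$; and $\mathcal R_{ij}^\ell(a,b)=0$ if $a=0$ or $b=0$. ''Asymptotically optimal sampling ratios'' means the $\boldsymbol r$-part of an optimal solution of the optimization problem in the claim. *)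

(* Defs.v *)
From HB Require Import structures.
From mathcomp Require Import all_boot all_order all_algebra perm.
From mathcomp Require Import all_classical all_reals all_analysis.

Set Implicit Arguments.
Unset Strict Implicit.
Unset Printing Implicit Defensive.

Import Order.TTheory GRing.Theory Num.Theory.
Import numFieldNormedType.Exports.

Local Open Scope classical_set_scope.
Local Open Scope ring_scope.

Section replications.
Context {d : measure_display} {T : measurableType d} {R : realType}
  (P : probability T R).

Definition mutually_independent (I : eqType) (X : I -> {RV P >-> R}) : Prop :=
  forall (s : seq I) (A : I -> set R), uniq s ->
    (forall i, i \in s -> measurable (A i)) ->
    P [set w | forall i, i \in s -> A i (X i w)] =
    (\prod_(i <- s) P (X i @^-1` A i))%E.

(* P and its pushforwards are arbitrary on non-measurable sets, so laws are
   compared on measurable sets only. *)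
Definition identically_distributed (X X' : {RV P >-> R}) : Prop :=
  forall A : set R, measurable A -> distribution P X A = distribution P X' A.

(* [Y h l s] is replication number s (counted from 0) of design h in
   context l.  One mutually independent family covers both independence
   between the replications of a pair and independence across pairs. *)
Definition iid_replications (k q : nat)
    (Y : 'I_k -> 'I_q -> nat -> {RV P >-> R}) (mean : 'I_k -> 'I_q -> R) :
    Prop :=
  [/\ mutually_independent
        (fun t : 'I_k * 'I_q * nat => Y t.1.1 t.1.2 t.2),
      forall h l s, identically_distributed (Y h l s) (Y h l 0%N)
    & forall h l s, 'E_P[Y h l s]%E = (mean h l)%:E].

Definition sample_mean (W : nat -> {RV P >-> R}) (n : nat) (w : T) : R :=
  n%:R^-1 * \sum_(s < n) W s w.

Definition scaled_log_mgf (W : nat -> {RV P >-> R}) (lam : R) (n : nat) :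
    \bar R :=
  ((n%:R^-1)%:E *
   lne 'E_P[fun w => expR (n%:R * lam * sample_mean W n w)])%E.

Definition Lam (W : nat -> {RV P >-> R}) (lam : R) : \bar R :=
  limn (scaled_log_mgf W lam).

End replications.

Section large_deviations.
Context {R : realType}.
Implicit Types (L f g : R -> \bar R).

Definition ederivable f (x : R) : Prop :=
  (\forall t \near x, f t \is a fin_num) /\ derivable (fine \o f) x 1.

(* Meaningful only at points where [ederivable f] holds; for a log moment
   generating function this is the whole interior of the effective domain. *)
Definition ederive f (x : R) : R := derive1 (fine \o f) x.

Definition eff_dom L : set R := [set lam | L lam < +oo]%E.

Definition slopes L : set R := [set ederive L lam | lam in (eff_dom L)°].

Definition legendre L (x : R) : \bar R :=
  ereal_sup [set ((lam * x)%:E - L lam)%E | lam in [set: R]].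

Definition strictly_convex_on (D : set R) f : Prop :=
  forall s t p : R, D s -> D t -> s != t -> 0 < p < 1 ->
    (f (p * s + (1 - p) * t)%R < p%:E * f s + (1 - p)%R%:E * f t)%E.

(* The interior is open, so its boundary is its closure minus itself; the
   sequences run inside the interior, where the derivative makes sense. *)
Definition steep L : Prop :=
  let D := (eff_dom L)° in
  forall (c : R) (u : nat -> R),
    (closure D `\` D) c -> (forall n, D (u n)) -> u @ \oo --> c ->
    (`|ederive L (u n)| : R) @[n --> \oo] --> +oo.

(* Requiring differentiability excludes the points near which f or g is
   identically +oo, where [fine] would make the derivative 0. *)
Definition stationary f g (a b x : R) : Prop :=
  [/\ ederivable f x, ederivable g x & a * ederive f x + b * ederive g x = 0].

(* For f, g two Legendre transforms and a, b >= 0.  [unique] pins x(a,b) as the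
   unique solution of the stationarity equation; f and g are finite at a
   stationary point, so [fine] loses nothing. *)
Definition rate f g (a b : R) : R :=
  if (a == 0) || (b == 0) then 0
  else let x := xget 0 [set x | unique (stationary f g a b) x] in
       a * fine (f x) + b * fine (g x).

End large_deviations.

Section problem.
Context {R : realType} (k m q : nat).
Implicit Types (y : 'I_k -> 'I_q -> R) (sigma : 'I_q -> {perm 'I_k}).

(* Ranks are counted from 0: [sigma l i] is the design of rank i.+1 in context
   l, so the top m designs are the ranks i < m. *)
Definition ranking y sigma : Prop :=
  forall l (i j : 'I_k),
    ((i <= j)%N -> y (sigma l j) l <= y (sigma l i) l) /\
    ((i < m <= j)%N -> y (sigma l j) l < y (sigma l i) l).

(* [Ls h l] is the Legendre transform attached to the pair (h, l). *)
Variable Ls : 'I_k -> 'I_q -> R -> \bar R.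

Definition pair_rate sigma (r : 'I_k -> 'I_q -> R) (l : 'I_q) (i j : 'I_k) :
    R :=
  rate (Ls (sigma l i) l) (Ls (sigma l j) l) (r (sigma l i) l) (r (sigma l j) l).

Definition feasible sigma (z : R) (r : 'I_k -> 'I_q -> R) : Prop :=
  [/\ forall (i j : 'I_k) l, (i < m <= j)%N ->
        0 <= pair_rate sigma r l i j - z,
      \sum_(h < k) \sum_(l < q) r (sigma l h) l = 1
    & forall (h : 'I_k) l, 0 <= r (sigma l h) l].

Definition optimal sigma (z : R) (r : 'I_k -> 'I_q -> R) : Prop :=
  feasible sigma z r /\ forall z' r', feasible sigma z' r' -> z' <= z.

(* The minima range over nonempty index sets when 0 < m < k; +oo is only the
   neutral element of mine. *)
Definition min_over_j sigma r (l : 'I_q) (i : 'I_k) : \bar R :=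
  \big[mine/+oo%E]_(j < k | (m <= j)%N) (pair_rate sigma r l i j)%:E.

Definition min_over_i sigma r (l : 'I_q) (j : 'I_k) : \bar R :=
  \big[mine/+oo%E]_(i < k | (i < m)%N) (pair_rate sigma r l i j)%:E.

End problem.

(* Main.v *)
Require Import Defs.
From HB Require Import structures.
From mathcomp Require Import all_boot all_order all_algebra perm.
From mathcomp Require Import all_classical all_reals all_analysis.
From mathcomp Require Import measurable_realfun.
From mathcomp Require Import ring lra.
Set Implicit Arguments.
Unset Strict Implicit.
Unset Printing Implicit Defensive.
Import Order.TTheory GRing.Theory Num.Theory.
Import numFieldNormedType.Exports.
Local Open Scope classical_set_scope.
Local Open Scope ring_scope.

(* Write L for the limiting log-mgf of a pair and f for its Legendre transform.
   By the tangent-line bound on exp, L lies above t |-> t * mean, and by Hoelder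
   it is convex.  Near the segment spanned by the means every slope of L is
   attained at a unique point and L has no kink there, so f is differentiable
   with continuous, strictly increasing derivative, and f vanishes only at the
   mean.  Hence, for ranks
   i <= m < j, the rate of (a, b) is the minimum of a * f_i + b * f_j over the
   segment between the two means; it is therefore positive for a, b > 0, and
   s * rate a b <= rate a' b' as soon as s * a <= a' and s * b <= b'.
   At an optimum z > 0 (try the uniform allocation), so all shares are positive.
   If all rates involving one pair exceeded z, one could shrink the share of that
   pair slightly and rescale the allocation to total 1, making every rate exceed
   z.  So each minimum in the statement equals z. *)

(** * The limiting log-moment generating function *)

Section ereal_no_minus_infinity.
Context {R : realType}.
Implicit Types (u v : \bar R) (r : R).

Lemma adde_defNy u v : u != -oo%E -> v != -oo%E -> (u +? v)%E.
Proof. by move=> uNy vNy; rewrite /adde_def !negb_and uNy vNy !orbT. Qed.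

Lemma pmule_neqNy r u : 0 < r -> u != -oo%E -> (r%:E * u)%E != -oo%E.
Proof. by move=> r0; case: u => //= _; rewrite gt0_muley ?lte_fin. Qed.

Lemma lne_neqNy u : (0 < u)%E -> lne u != -oo%E.
Proof. by case: u => [r r0| |]//; rewrite lne_EFin. Qed.

End ereal_no_minus_infinity.

Section log_mgf.
Context {d : measure_display} {T : measurableType d} {R : realType}
  (P : probability T R).
Implicit Types (U V : T -> R) (W : nat -> {RV P >-> R}).

Lemma expR_tangent (c u : R) : expR c * (1 + (u - c)) <= expR u.
Proof.
rewrite -[in leRHS](subrK c u) expRD [leRHS]mulrC.
by rewrite ler_pM2l ?expR_gt0// expR_ge1Dx.
Qed.

(** Jensen's inequality for [expR], obtained by integrating the tangent at the mean c; the case of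
    an infinite exponential moment is trivial. *)
Lemma expectation_expR_ge V (c : R) : measurable_fun setT V ->
  P.-integrable setT (EFin \o V) -> 'E_P[V]%E = c%:E ->
  ((expR c)%:E <= 'E_P[fun w => expR (V w)])%E.
Proof.
move=> mV iV; rewrite !unlock => EV.
have me : measurable_fun setT (EFin \o (fun w => expR (V w))).
  by apply/measurable_EFinP; exact: (measurableT_comp (@measurable_expR R)).
have [Ey|/eqP Ey] := eqVneq (\int[P]_w (expR (V w))%:E)%E +oo%E.
  by rewrite Ey leey.
have ie : P.-integrable setT (fun w => (expR (V w))%:E).
  apply/integrableP; split => //.
  under eq_integral do rewrite gee0_abs ?lee_fin ?expR_ge0//.
  by rewrite ltey; exact/eqP.
have -> : ((expR c)%:E =
    \int[P]_w ((expR c * (1 - c))%:E + (expR c)%:E * (V w)%:E))%E.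
  have ic : P.-integrable setT (fun=> (expR c * (1 - c))%:E).
    exact: finite_measure_integrable_cst.
  rewrite integralD//; last exact: integrableZl.
  rewrite integral_cst//= probability_setT mule1 integralZl// EV -EFinM -EFinD.
  congr EFin; ring.
apply: le_integral => //.
  apply: integrableD => //; last exact: integrableZl.
  exact: finite_measure_integrable_cst.
move=> w _; rewrite -EFinM -EFinD lee_fin (le_trans _ (expR_tangent c _))//.
by lra.
Qed.

(* The two-point case of Hoelder's inequality: normalising both moments to 1,
   it is the convexity of [expR]. *)
Lemma lne_mgf_convex U V (p : R) : 0 < p < 1 ->
  measurable_fun setT U -> measurable_fun setT V ->
  (0 < 'E_P[fun w => expR (U w)])%E -> (0 < 'E_P[fun w => expR (V w)])%E ->
  (lne 'E_P[fun w => expR (p * U w + (1 - p) * V w)] <=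
   p%:E * lne 'E_P[fun w => expR (U w)] +
   (1 - p)%:E * lne 'E_P[fun w => expR (V w)])%E.
Proof.
move=> /andP[p0 p1] mU mV; rewrite !unlock => EU0 EV0.
have q0 : 0 < 1 - p by rewrite subr_gt0.
have mexp (f : T -> R) : measurable_fun setT f ->
    measurable_fun setT (EFin \o (fun w => expR (f w))).
  by move=> mf; apply/measurable_EFinP; exact: (measurableT_comp (@measurable_expR R)).
case EU : (\int[P]_w (expR (U w))%:E)%E EU0 => [A| |]// A0; last first.
  rewrite [lne +oo%E]/= gt0_muley ?lte_fin//.
  case EV : (\int[P]_w (expR (V w))%:E)%E EV0 => [B| |]// B0.
    by rewrite lne_EFin ?leey.
  by rewrite [lne +oo%E]/= gt0_muley ?lte_fin// leey.
case EV : (\int[P]_w (expR (V w))%:E)%E EV0 => [B| |]// B0; last first.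
  by rewrite [lne +oo%E]/= gt0_muley ?lte_fin// lne_EFin// leey.
rewrite lte_fin in A0; rewrite lte_fin in B0.
rewrite !lne_EFin// -!EFinM -EFinD.
(* [expR K] is A^p B^(1-p). Below it is spread over [expR (U w)] / A and [expR (V w)] / B with
   weights p and 1 - p, both normalised moments being 1. *)
set K := p * ln A + (1 - p) * ln B.
suff IK : (\int[P]_w (expR (p * U w + (1 - p) * V w))%:E <= (expR K)%:E)%E.
  rewrite -[leRHS]expeRK lee_lne// !in_itv /= !leey !andbT.
    by apply: integral_ge0 => w _; rewrite lee_fin expR_ge0.
  by rewrite lee_fin expR_ge0.
have -> : ((expR K)%:E = \int[P]_w ((expR K * p / A)%:E * (expR (U w))%:E +
   (expR K * (1 - p) / B)%:E * (expR (V w))%:E))%E.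
  rewrite ge0_integralD//=; last 4 first.
  - move=> w _; rewrite mule_ge0 ?lee_fin ?expR_ge0//.
    by rewrite !mulr_ge0 ?invr_ge0 ?expR_ge0// ltW.
  - by apply: measurable_funeM; exact: mexp.
  - move=> w _; rewrite mule_ge0 ?lee_fin ?expR_ge0//.
    by rewrite !mulr_ge0 ?invr_ge0 ?expR_ge0// ltW.
  - by apply: measurable_funeM; exact: mexp.
  rewrite !ge0_integralZl_EFin//=; last 4 first.
  - exact: mexp.
  - by rewrite !mulr_ge0 ?invr_ge0 ?expR_ge0// ltW.
  - exact: mexp.
  - by rewrite !mulr_ge0 ?invr_ge0 ?expR_ge0// ltW.
  rewrite EU EV -!EFinM -EFinD; congr EFin.
  by field; rewrite !gt_eqF.
apply: ge0_le_integral => //.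
- apply: mexp; apply: measurable_funD; exact: measurable_funM.
- apply: emeasurable_funD; apply: measurable_funeM; exact: mexp.
move=> w _; rewrite -!EFinM -EFinD lee_fin.
set c := p * U w + (1 - p) * V w.
(* Both tangents are taken at c - K, the average of the two exponents with weights p and 1 - p, so
   the linear terms cancel. *)
have hU := expR_tangent (c - K) (U w - ln A).
have hV := expR_tangent (c - K) (V w - ln B).
have -> : expR c = expR K * expR (c - K) by rewrite -expRD addrC subrK.
rewrite -!mulrA -mulrDr ler_pM2l ?expR_gt0//.
have -> : A^-1 * expR (U w) = expR (U w - ln A).
  by rewrite expRD expRN lnK// mulrC.
have -> : B^-1 * expR (V w) = expR (V w - ln B).
  by rewrite expRD expRN lnK// mulrC.
apply: (le_trans _ (lerD (ler_wpM2l (ltW p0) hU) (ler_wpM2l (ltW q0) hV))).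
by rewrite /K /c; lra.
Qed.

(** The integral is the difference of those of the positive and negative parts, which is finite only
    when both are. *)
Lemma fin_expectation_integrable (X : {RV P >-> R}) (c : R) :
  'E_P[X]%E = c%:E -> P.-integrable setT (EFin \o X).
Proof.
rewrite unlock integralE => EX; apply/integrableP; split.
  exact/measurable_EFinP.
have mX : measurable_fun setT (EFin \o X) by exact/measurable_EFinP.
have pge0 : (0 <= \int[P]_w ((fun w => (X w)%:E)^\+ w))%E by exact: integral_ge0.
have nge0 : (0 <= \int[P]_w ((fun w => (X w)%:E)^\- w))%E by exact: integral_ge0.
have -> : (\int[P]_w `|(EFin \o X) w| = \int[P]_w ((fun w => (X w)%:E)^\+ w)
   + \int[P]_w ((fun w => (X w)%:E)^\- w))%E.
  rewrite -ge0_integralD//; last 2 first.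
  - exact: measurable_funepos.
  - exact: measurable_funeneg.
  by rewrite -[in LHS]/(abse \o _) fune_abse.
move: EX pge0 nge0.
by case: integral => [a| |]//; case: integral => [b| |]// _ _ _; rewrite -EFinD ltry.
Qed.

(** * Exponential moments of sample means *)

Section iid_mean.
Variables (W : nat -> {RV P >-> R}) (mu : R).
Hypothesis W_mean : forall s, 'E_P[W s]%E = mu%:E.

Lemma measurable_scaled_mean lam n :
  measurable_fun setT (fun w => n%:R * lam * sample_mean W n w).
Proof.
apply: measurable_funM => //; apply: measurable_funM => //.
exact: measurable_sum.
Qed.

Lemma mgf_sample_mean_ge lam n : (0 < n)%N ->
  ((expR (n%:R * (lam * mu)))%:E <=
   'E_P[fun w => expR (n%:R * lam * sample_mean W n w)])%E.
Proof.
move=> n0; have n0' : n%:R != 0 :> R by rewrite pnatr_eq0 -lt0n.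
have SE w : ((n%:R * lam * sample_mean W n w)%:E =
             lam%:E * \sum_(s < n) (W s w)%:E)%E.
  rewrite sumEFin -EFinM; congr EFin; rewrite /sample_mean.
  by rewrite [n%:R * lam]mulrC mulrA mulfK.
have iS : P.-integrable setT (fun w => \sum_(s < n) (W s w)%:E)%E.
  by apply: integrable_sum => // s _; exact: fin_expectation_integrable (W_mean s).
apply: expectation_expR_ge.
- exact: measurable_scaled_mean.
- rewrite (_ : EFin \o _ = fun w => lam%:E * \sum_(s < n) (W s w)%:E)%E.
    exact: integrableZl.
  by apply/funext => w /=; rewrite SE.
- rewrite unlock; under eq_integral do rewrite SE.
  rewrite integralZl// integral_sum//; last first.
    by move=> s; exact: fin_expectation_integrable (W_mean s).
  rewrite (eq_bigr (fun=> mu%:E)); last by move=> s _; rewrite -(W_mean s) unlock.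
  by rewrite sumEFin -EFinM sumr_const card_ord -mulr_natl; congr EFin; ring.
Qed.

Lemma mgf_sample_mean_gt0 lam n : (0 < n)%N ->
  (0 < 'E_P[fun w => expR (n%:R * lam * sample_mean W n w)])%E.
Proof.
by move=> n0; apply: lt_le_trans (mgf_sample_mean_ge lam n0); rewrite lte_fin expR_gt0.
Qed.

Lemma Lam0 : Lam W 0 = 0%E.
Proof.
rewrite /Lam (_ : scaled_log_mgf W 0 = fun=> 0%E) ?lim_cst//.
apply/funext => n; rewrite /scaled_log_mgf.
under eq_fun do rewrite mulr0 mul0r expR0.
by rewrite expectation_cst lne1 mule0.
Qed.

(** For n > 0 Jensen's inequality bounds each term of the sequence below by lam * mu; the bound
    passes to the limit. *)
Lemma Lam_ge_mean lam : cvgn (scaled_log_mgf W lam) ->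
  ((lam * mu)%:E <= Lam W lam)%E.
Proof.
move=> cvgW; apply: (lee_cvg_to (cvg_cst _) cvgW).
near=> n; have n0 : (0 < n)%N by near: n; exact: nbhs_infty_gt.
have n0' : 0 < n%:R :> R by rewrite ltr0n.
rewrite /scaled_log_mgf muleC lee_pdivlMr// -EFinM mulrC -[leLHS]expeRK.
rewrite lee_lne ?mgf_sample_mean_ge// in_itv/= leey andbT ?lee_fin ?expR_ge0//.
exact/ltW/mgf_sample_mean_gt0.
Unshelve. all: by end_near. Qed.

(** Hoelder's inequality at each n > 0 passes to the limit; [Lam_ge_mean] excludes -oo, so the limit
    of the right-hand sum is defined. *)
Lemma Lam_convex : (forall lam, cvgn (scaled_log_mgf W lam)) ->
  forall s t p : R, 0 < p < 1 ->
  (Lam W (p * s + (1 - p) * t)%R <= p%:E * Lam W s + (1 - p)%:E * Lam W t)%E.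
Proof.
move=> cvgW s t p p01; have /andP[p0 p1] := p01.
have Ny lam : Lam W lam != -oo%E.
  by rewrite gt_eqF// (lt_le_trans _ (Lam_ge_mean (cvgW lam)))// ltNyr.
apply: (lee_cvg_to (cvgW _)); first apply: cvgeD.
- by apply: adde_defNy; apply: pmule_neqNy; rewrite ?subr_gt0.
- by apply: cvgeZl => //; exact: cvgW.
- by apply: cvgeZl => //; exact: cvgW.
near=> n; have n0 : (0 < n)%N by near: n; exact: nbhs_infty_gt.
have n0' : 0 < n%:R^-1 :> R by rewrite invr_gt0 ltr0n.
have := lne_mgf_convex p01 (measurable_scaled_mean s n)
  (measurable_scaled_mean t n) (mgf_sample_mean_gt0 s n0) (mgf_sample_mean_gt0 t n0).
rewrite /scaled_log_mgf /= 2!(muleCA _ (n%:R^-1)%:E) -muleDr//; last first.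
  by apply: adde_defNy; apply: pmule_neqNy; rewrite ?subr_gt0//;
    apply/lne_neqNy/mgf_sample_mean_gt0.
rewrite lee_pmul2l// => /(le_trans _); apply; rewrite le_eqVlt; apply/orP; left.
by apply/eqP; congr (lne (expectation _ _)); apply/funext => w; congr expR; ring.
Unshelve. all: by end_near. Qed.

End iid_mean.

End log_mgf.

(** * Subgradients and the Legendre transform *)

Section convex_functions.
Context {R : realType}.
Implicit Types (F : R -> \bar R) (f : R -> R).

Definition econvex F := forall s t p : R, 0 < p < 1 ->
  (F (p * s + (1 - p) * t)%R <= p%:E * F s + (1 - p)%R%:E * F t)%E.

(** For finite [L lam], [subgradient L lam x] says that lam attains the supremum defining
    [legendre L x]. *)
Definition subgradient F (x s : R) :=
  forall t : R, (F x + (s * (t - x))%:E <= F t)%E.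

Lemma derive_epsP f (x l : R) :
  (derivable f x 1 /\ derive1 f x = l) <->
  forall e, 0 < e -> exists2 del, 0 < del & forall t, `|t - x| < del ->
    `|f t - f x - l * (t - x)| <= e * `|t - x|.
Proof.
have dqE h t : h = t - x -> h != 0 ->
    `|l - h^-1 *: (f (h *: 1 + x) - f x)| = `|f t - f x - l * (t - x)| / `|t - x|.
  move=> -> h0; rewrite /GRing.scale /= mulr1 subrK -normfV -normrM -normrN.
  by congr `|_|; field.
split=> [[df dl] e e0|H].
  have : h^-1 *: (f (h *: 1 + x) - f x) @[h --> 0^'] --> l.
    by rewrite -dl derive1E; exact: df.
  move/cvgrPdist_le => /(_ _ e0) /nbhs_ballP[del /= del0 B]; exists del => // t tx.
  have [tx0|tx0] := eqVneq (t - x) 0.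
    by rewrite tx0 mulr0 subr0 normr0 mulr0 (subr0_eq tx0) subrr normr0.
  have := B (t - x); rewrite -ball_normE /ball_ /= sub0r normrN => /(_ tx tx0).
  by rewrite (dqE _ t)// ler_pdivrMr ?normr_gt0.
have cv : h^-1 *: (f (h *: 1 + x) - f x) @[h --> 0^'] --> l.
  apply/cvgrPdist_le => e e0; have [del del0 B] := H e e0.
  apply/nbhs_ballP; exists del => //= h; rewrite -ball_normE /ball_ /= sub0r normrN => hd h0.
  have := B (h + x); rewrite addrK => /(_ hd).
  by rewrite (dqE _ (h + x)) ?addrK// ler_pdivrMr ?normr_gt0.
split; first by apply: cvgP cv.
by rewrite derive1E; exact: cvg_lim cv.
Qed.

Lemma derive1_neq0_derivable f (x : R) : derive1 f x != 0 -> derivable f x 1.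
Proof. by apply: contra_neqP; rewrite derive1E => /dvgP. Qed.

(** If the tangent passed above F at t, convexity would keep F below the tangent near x by an amount
    proportional to the distance to x, against differentiability. *)
Lemma derivable_subgradient F (x : R) : (forall t, F t != -oo%E) ->
  econvex F -> F x \is a fin_num -> derivable (fine \o F) x 1 ->
  subgradient F x (ederive F x).
Proof.
move=> FNy Fcvx Fx dF t; set l := ederive F x.
have [-> |tx] := eqVneq t x; first by rewrite subrr mulr0 adde0.
case Ft : (F t) (FNy t) => [b| |]// _; last by rewrite leey.
rewrite -(fineK Fx) -EFinD lee_fin leNgt; apply/negP => blt.
set a := fine (F x) in blt; set v := t - x in blt.
have v0 : 0 < `|v| by rewrite normr_gt0 subr_eq0.
pose gap := a + l * v - b; have gap0 : 0 < gap by rewrite subr_gt0.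
(* With this tolerance the error allowed at x + p * v is p * gap / 2, while convexity forces a
   deficit of at least p * gap. *)
have e0 : 0 < gap / 2 / `|v| by rewrite !divr_gt0.
have [del del0 B] := (derive_epsP _ _ _).1 (conj dF (erefl l)) _ e0.
pose p := Num.min (1 / 2) (del / 2 / `|v|).
have p0 : 0 < p by rewrite lt_min; apply/andP; split; rewrite !divr_gt0.
have p1 : p < 1 by rewrite gt_min; apply/orP; left; lra.
have pv : p * `|v| < del.
  rewrite -ltr_pdivlMr// (@le_lt_trans _ _ (del / 2 / `|v|))//.
    by rewrite ge_min lexx orbT.
  by rewrite ltr_pM2r ?invr_gt0//; lra.
have := B (x + p * v); rewrite addrAC subrr add0r normrM (gtr0_norm p0).
move=> /(_ pv) /=; rewrite -/a.
have := Fcvx t x p; rewrite p0 p1 => /(_ isT).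
rewrite Ft -(fineK Fx) -/a -!EFinM -EFinD.
have -> : p * t + (1 - p) * x = x + p * v by rewrite /v; ring.
case: (F (x + p * v)) (FNy (x + p * v)) => [c| |]//= _.
rewrite lee_fin ler_norml => cle /andP[+ _].
have -> : gap / 2 / `|v| * (p * `|v|) = p * (gap / 2) by field; rewrite gt_eqF.
move=> ge; have : 0 < p * (gap / 2) by rewrite mulr_gt0// divr_gt0.
by move: cle ge; rewrite /gap; lra.
Qed.

End convex_functions.

(** * Points where a line of given slope supports L *)

Section conjugate.
Context {R : realType} (L : R -> \bar R) (mu : R).
Local Notation D := ((eff_dom L)°).
Local Notation U := ((slopes L)°).
Local Notation l := (fine \o L).
Hypothesis L0 : L 0 = 0%E.
Hypothesis D0 : D 0.
Hypothesis L_ge : forall t, ((t * mu)%:E <= L t)%E.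
Hypothesis L_cvx : econvex L.
Hypothesis L_sc : strictly_convex_on D L.
Hypothesis L_cont : forall t : R, D t -> {for t, continuous L}.

Let L_neqNy (t : R) : L t != -oo%E.
Proof. by rewrite gt_eqF// (lt_le_trans _ (L_ge t))// ltNyr. Qed.

Let L_fin (t : R) : D t -> L t = (l t)%:E.
Proof.
move=> /interior_subset Lt; rewrite /= fineK// fin_numE L_neqNy /=.
by rewrite lt_eqF.
Qed.

(** The chord bounds L by finite values on all of ]s, t[, a neighbourhood of u. *)
Let D_between (s t u : R) : D s -> D t -> s <= u <= t -> D u.
Proof.
move=> Ds Dt /andP[]; rewrite le_eqVlt => /predU1P[<-//|su].
rewrite le_eqVlt => /predU1P[->//|ut].
have itv_nbhs : \forall w \near u, w \in `]s, t[.
  by apply: near_in_itvoo; rewrite in_itv /= su ut.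
rewrite /interior /=; apply: filterS itv_nbhs => w; rewrite in_itv /= => /andP[sw wt].
have st : 0 < t - s by rewrite subr_gt0 (lt_trans sw).
have p01 : 0 < (t - w) / (t - s) < 1.
  by rewrite ltr_pdivlMr// ltr_pdivrMr// mul0r mul1r; apply/andP; split; lra.
have := L_cvx s t p01.
have -> : (t - w) / (t - s) * s + (1 - (t - w) / (t - s)) * t = w.
  by field; rewrite gt_eqF.
by rewrite (L_fin Ds) (L_fin Dt) -!EFinM -EFinD => /le_lt_trans; apply; exact: ltry.
Qed.

Let L_secant (s t u : R) : D s -> D t -> s < u < t ->
  (t - s) * l u < (t - u) * l s + (u - s) * l t.
Proof.
move=> Ds Dt /andP[su ut].
have st : 0 < t - s by rewrite subr_gt0 (lt_trans su).
have Du : D u by apply: D_between Ds Dt _; rewrite !ltW.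
have p01 : 0 < (t - u) / (t - s) < 1.
  by rewrite ltr_pdivlMr// ltr_pdivrMr// mul0r mul1r; apply/andP; split; lra.
have sNt : s != t by rewrite lt_eqF// (lt_trans su).
have := L_sc Ds Dt sNt p01.
have -> : (t - u) / (t - s) * s + (1 - (t - u) / (t - s)) * t = u.
  by field; rewrite gt_eqF.
rewrite (L_fin Ds) (L_fin Dt) (L_fin Du) -!EFinM -EFinD lte_fin.
rewrite -(ltr_pM2l st) => /lt_le_trans; apply.
by rewrite le_eqVlt; apply/orP; left; apply/eqP; field; rewrite gt_eqF.
Qed.

Let subgradient_le (x lam t : R) : D lam -> subgradient L lam x -> D t ->
  l lam + x * (t - lam) <= l t.
Proof. by move=> Dl /(_ t) + Dt; rewrite (L_fin Dl) (L_fin Dt) -EFinD lee_fin. Qed.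

(* [derive1] is 0 where the derivative does not exist, so only a nonzero slope
   is certainly a genuine derivative. *)
Let slope_subgradient (u : R) : slopes L u -> u != 0 ->
  exists lam : R, [/\ D lam, ederive L lam = u & subgradient L lam u].
Proof.
move=> [lam Dlam lamu] u0; exists lam; split => //.
rewrite -lamu; apply: derivable_subgradient => //; first by rewrite L_fin.
by apply: derive1_neq0_derivable; rewrite -/(ederive L lam) lamu.
Qed.

(** An interior slope leaves room towards y. A nonzero slope is a genuine derivative; if the first
    candidate is 0, halving p avoids it. *)
Let nonzero_slope_near (x y : R) : U x -> y != x ->
  exists p : R, [/\ 0 < p, p < 1, x + p * (y - x) != 0 & slopes L (x + p * (y - x))].
Proof.
move=> /nbhs_ballP[e /= e0]; rewrite -ball_normE => xe yx.
have v0 : 0 < `|y - x| by rewrite normr_gt0 subr_eq0.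
pose p0 := Num.min (1 / 2) (e / 2 / `|y - x|).
have p0_gt0 : 0 < p0 by rewrite lt_min; apply/andP; split; rewrite !divr_gt0.
have p0_lt1 : p0 < 1 by rewrite gt_min; apply/orP; left; lra.
have p0e : p0 * `|y - x| < e.
  rewrite -ltr_pdivlMr// (@le_lt_trans _ _ (e / 2 / `|y - x|))//.
    by rewrite ge_min lexx orbT.
  by rewrite ltr_pM2r ?invr_gt0//; lra.
have sl p : 0 < p <= p0 -> slopes L (x + p * (y - x)).
  move=> /andP[p_gt0 pp0]; apply: xe => /=.
  rewrite opprD addrA subrr add0r normrN normrM gtr0_norm//.
  by apply: le_lt_trans p0e; rewrite ler_pM2r.
have [z0|] := eqVneq (x + p0 * (y - x)) 0; last first.
  by exists p0; split => //; apply: sl; rewrite p0_gt0 lexx.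
exists (p0 / 2); split; [lra|lra| |by apply: sl; apply/andP; split; lra].
have -> : x + p0 / 2 * (y - x) = x + p0 * (y - x) - p0 / 2 * (y - x) by field.
by rewrite z0 sub0r oppr_eq0 mulf_neq0// ?subr_eq0// gt_eqF// divr_gt0.
Qed.

Let subgradient_mono (x y lam nu : R) : D lam -> D nu ->
  subgradient L lam x -> subgradient L nu y -> x < y -> lam <= nu.
Proof.
move=> Dl Dn sx sy xy.
have h1 := subgradient_le Dl sx Dn; have h2 := subgradient_le Dn sy Dl.
rewrite leNgt; apply/negP => nl.
have : 0 < (y - x) * (lam - nu) by rewrite mulr_gt0 ?subr_gt0.
lra.
Qed.

(** Nonzero slopes s < x < t are attained at some a <= b. On [a, b] the continuous function l u - x
    * u has a minimum; outside, the tangents of slopes s and t keep it above its values at a and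
    b. *)
Let subgradient_exists (x : R) : U x -> exists2 lam : R, D lam & subgradient L lam x.
Proof.
move=> Ux.
have [p [p0 _ s0 ss]] : exists p : R, [/\ 0 < p, p < 1, x + p * (x - 1 - x) != 0
    & slopes L (x + p * (x - 1 - x))].
  by apply: nonzero_slope_near => //; rewrite lt_eqF// ltrBlDr ltrDl.
have [q [q0 _ t0 tt]] : exists p : R, [/\ 0 < p, p < 1, x + p * (x + 1 - x) != 0
    & slopes L (x + p * (x + 1 - x))].
  by apply: nonzero_slope_near => //; rewrite gt_eqF// ltrDl.
have [a [Da _ sa]] := slope_subgradient ss s0.
have [b [Db _ sb]] := slope_subgradient tt t0.
set s := (x + _) in sa; set t := (x + _) in sb.
have sx : s < x by rewrite /s; lra.
have xt : x < t by rewrite /t; lra.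
have ab : a <= b by apply: subgradient_mono Da Db sa sb _; exact: lt_trans xt.
have cf : {within `[a, b], continuous (fun u => l u - x * u)}.
  apply: continuous_in_subspaceT => u; rewrite inE /= in_itv /= => uab.
  have Du : D u by exact: D_between uab.
  apply: cvgB; last by apply: cvgM; [exact: cvg_cst|exact: cvg_id].
  by apply: fine_cvg; rewrite -L_fin//; exact: L_cont.
have [c cab cmin] := EVT_min ab cf; have Dc : D c by exact: D_between cab.
exists c => // u.
case Lu : (L u) (L_neqNy u) => [lu| |]// _; last by rewrite leey.
rewrite L_fin// -EFinD lee_fin.
have sau : l a + s * (u - a) <= lu.
  by have := sa u; rewrite L_fin// Lu -EFinD lee_fin.
have sbu : l b + t * (u - b) <= lu.
  by have := sb u; rewrite L_fin// Lu -EFinD lee_fin.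
have ca := cmin a; have cb := cmin b.
rewrite in_itv /= lexx ab /= in ca; rewrite in_itv /= lexx ab /= in cb.
have {}ca := ca isT; have {}cb := cb isT.
have [ua|au] := ltP u a.
  have : 0 <= (x - s) * (a - u) by rewrite mulr_ge0// subr_ge0 ltW.
  by move: sau ca => /=; lra.
have [ub|bu] := leP u b.
  have := cmin u; rewrite in_itv /= au ub Lu /= => /(_ isT); lra.
have : 0 <= (t - x) * (u - b) by rewrite mulr_ge0// subr_ge0 ltW.
by move: sbu cb => /=; lra.
Qed.

(** At the midpoint of lam and nu, l is above the tangent but strictly below its chord, so it is
    strictly above the tangent at nu. *)
Let subgradient_lt (x lam nu : R) : D lam -> D nu -> subgradient L lam x ->
  nu != lam -> l lam + x * (nu - lam) < l nu.
Proof.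
move=> Dl Dn sl; set m := (lam + nu) / 2.
have Dm : D m.
  have [ln|nl] := leP lam nu.
    by apply: D_between Dl Dn _; apply/andP; split; rewrite /m; lra.
  by apply: D_between Dn Dl _; apply/andP; split; rewrite /m; lra.
have h := subgradient_le Dl sl Dm.
have dE : m - lam = (nu - lam) / 2 by rewrite /m; field.
rewrite neq_lt => /orP[nl|ln].
  have min : nu < m < lam by apply/andP; split; rewrite /m; lra.
  have := L_secant Dn Dl min; rewrite dE in h.
  have -> : lam - m = (lam - nu) / 2 by rewrite /m; field.
  have -> : m - nu = (lam - nu) / 2 by rewrite /m; field.
  rewrite -!mulrA -mulrDr ltr_pM2l ?subr_gt0//; lra.
have min : lam < m < nu by apply/andP; split; rewrite /m; lra.
have := L_secant Dl Dn min; rewrite dE in h *.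
have -> : nu - m = (nu - lam) / 2 by rewrite /m; field.
rewrite -!mulrA -mulrDr ltr_pM2l ?subr_gt0//; lra.
Qed.

Let subgradient_unique (x lam nu : R) : D lam -> D nu ->
  subgradient L lam x -> subgradient L nu x -> lam = nu.
Proof.
move=> Dl Dn sl sn; apply/eqP/negPn/negP => ln.
have := subgradient_lt Dn Dl sn ln; have := subgradient_le Dl sl Dn; lra.
Qed.

(** With x and y, all intermediate slopes would be subgradients at lam. Two distinct nonzero ones
    near x are derivatives of L, both at lam by uniqueness of the contact point: a contradiction. *)
Let no_kink (x y lam : R) : U x -> y != x -> D lam ->
  subgradient L lam x -> ~ subgradient L lam y.
Proof.
move=> Ux yx Dl sx sy.
have between p : 0 < p -> p < 1 -> subgradient L lam (x + p * (y - x)).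
  move=> p0 p1 t; have := sx t; have := sy t.
  case: (L t) (L_neqNy t) => [lt| |]// _; last by rewrite !leey.
  rewrite L_fin// -!EFinD !lee_fin => h1 h2.
  have q0 : 0 <= 1 - p by lra.
  have := ler_wpM2l (ltW p0) h1; have := ler_wpM2l q0 h2; lra.
have slope p : 0 < p -> p < 1 -> x + p * (y - x) != 0 ->
    slopes L (x + p * (y - x)) -> ederive L lam = x + p * (y - x).
  move=> p0 p1 u0 /slope_subgradient /(_ u0) [nu [Dn nuE sn]].
  by rewrite -nuE; congr ederive; apply: subgradient_unique sn => //; exact: between.
have [p [p0 p1 u0 su]] := nonzero_slope_near Ux yx.
have yx' : x + p * (y - x) != x.
  by rewrite -subr_eq0 addrAC subrr add0r mulf_neq0 ?subr_eq0// gt_eqF.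
have [q [q0 q1]] := nonzero_slope_near Ux yx'.
have -> : x + q * (x + p * (y - x) - x) = x + (q * p) * (y - x) by ring.
move=> v0 sv; have qp : q * p < p by rewrite gtr_pMl.
have := slope p p0 p1 u0 su.
rewrite (slope (q * p))// ?mulr_gt0//; last exact: lt_trans p1.
move/addrI/(mulIf _); rewrite subr_eq0 => /(_ yx) qpE.
by move: qp; rewrite qpE ltxx.
Qed.

(** * The conjugate and its derivative *)

Lemma legendre_ge (t x : R) : ((t * x)%:E - L t <= legendre L x)%E.
Proof. by apply: ereal_sup_ubound; exists t. Qed.

Lemma legendre_ge0 (x : R) : (0 <= legendre L x)%E.
Proof. by have := legendre_ge 0 x; rewrite mul0r L0 sube0. Qed.

Let legendre_neqNy (x : R) : legendre L x != -oo%E.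
Proof. by rewrite gt_eqF// (lt_le_trans _ (legendre_ge0 x)). Qed.

Lemma econvex_legendre : econvex (legendre L).
Proof.
move=> s t p /andP[p0 p1]; have q0 : 0 < 1 - p by rewrite subr_gt0.
apply: ge_ereal_sup => _ [u _ <-].
have := legendre_ge u s; have := legendre_ge u t.
case: (L u) (L_neqNy u) => [lu| |]// _; last by rewrite !addeNy !leNye.
case: (legendre L s) (legendre_neqNy s) => [ls| |]// _; last first.
  rewrite gt0_muley ?lte_fin// addye ?leey//; exact: pmule_neqNy.
case: (legendre L t) (legendre_neqNy t) => [lt| |]// _; last first.
  by rewrite gt0_muley ?lte_fin// addey ?leey.
rewrite -?EFinM -!EFinD !lee_fin => h1 h2.
have := ler_wpM2l (ltW q0) h1; have := ler_wpM2l (ltW p0) h2; lra.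
Qed.

(** The equality case of the Fenchel-Young inequality [legendre_ge]. *)
Let legendreE (x lam : R) : D lam -> subgradient L lam x ->
  legendre L x = (lam * x - l lam)%:E.
Proof.
move=> Dl sl; apply/eqP; rewrite eq_le; apply/andP; split; last first.
  by have := legendre_ge lam x; rewrite L_fin.
apply: ge_ereal_sup => _ [t _ <-]; have := sl t.
case: (L t) (L_neqNy t) => [lt| |]// _; last by rewrite !addeNy !leNye.
by rewrite L_fin// -EFinD -EFinB !lee_fin; lra.
Qed.

Let subgradient_legendre (x lam : R) : D lam -> subgradient L lam x ->
  subgradient (legendre L) x lam.
Proof.
move=> Dl sl t; rewrite (legendreE Dl sl) -EFinD.
apply: le_trans (legendre_ge lam t); rewrite L_fin// -EFinB lee_fin; lra.
Qed.

(** By strictness, l exceeds the tangent at lam by positive margins at lam - e and lam + e. For t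
    close to x the line of slope t through the same contact point stays below l there, so by
    convexity no contact point of slope t lies beyond them. *)
Let subgradient_continuous (x lam : R) : U x -> D lam -> subgradient L lam x ->
  forall e, 0 < e -> exists2 del, 0 < del & forall t, `|t - x| < del ->
    U t /\ forall nu, D nu -> subgradient L nu t -> `|nu - lam| <= e.
Proof.
move=> Ux Dl sl e0 e0_gt0.
have /nbhs_ballP[e1 /= e1_gt0] : nbhs lam D.
  by apply: open_nbhs_nbhs; split => //; exact: open_interior.
rewrite -ball_normE => De1.
pose e := Num.min e0 (e1 / 2).
have e_gt0 : 0 < e by rewrite lt_min e0_gt0 divr_gt0.
have ee0 : e <= e0 by rewrite ge_min lexx.
have ee1 : e < e1.
  by apply: (@le_lt_trans _ _ (e1 / 2)); [rewrite ge_min lexx orbT|lra].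
have Dp : D (lam + e).
  by apply: De1 => /=; rewrite opprD addrA subrr add0r normrN gtr0_norm.
have Dm : D (lam - e).
  by apply: De1 => /=; rewrite opprB addrC subrK gtr0_norm.
have up : 0 < l (lam + e) - l lam - x * e.
  have /(subgradient_lt Dl Dp sl) : lam + e != lam by rewrite gt_eqF// ltrDl.
  by rewrite addrAC subrr add0r; lra.
have um : 0 < l (lam - e) - l lam + x * e.
  have /(subgradient_lt Dl Dm sl) : lam - e != lam by rewrite lt_eqF// ltrBlDr ltrDl.
  by rewrite addrAC subrr add0r; lra.
have /nbhs_ballP[e2 /= e2_gt0] : nbhs x U.
  by apply: open_nbhs_nbhs; split => //; exact: open_interior.
rewrite -ball_normE => Ue2.
exists (Num.min e2 (Num.min ((l (lam + e) - l lam - x * e) / e)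
                            ((l (lam - e) - l lam + x * e) / e))).
  by rewrite !lt_min e2_gt0 !divr_gt0.
move=> t; rewrite !lt_min => /and3P[te2 tp tm]; split.
  by apply: Ue2 => /=; rewrite distrC.
move=> nu Dn sn.
rewrite !ltr_pdivlMr// in tm tp; apply: le_trans ee0.
have := ler_norm (t - x); rewrite -(ler_pM2r e_gt0) => tx.
have := ler_norm (x - t); rewrite distrC -(ler_pM2r e_gt0) => xt.
have h := subgradient_le Dn sn Dl.
rewrite ler_norml lerBrDl lerBlDl; apply/andP; split; rewrite leNgt; apply/negP.
  move=> nle; have sec : nu < lam - e < lam by apply/andP; split; lra.
  have := L_secant Dn Dl sec.
  have ln : 0 < lam - nu by lra.
  have : (lam - nu) * (l lam - t * e) < (lam - nu) * l (lam - e).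
    by rewrite ltr_pM2l//; lra.
  by have := ler_wpM2l (ltW e_gt0) h; lra.
move=> len; have sec : lam < lam + e < nu by apply/andP; split; lra.
have := L_secant Dl Dn sec.
have ln : 0 < nu - lam by lra.
have : (nu - lam) * (l lam + t * e) < (nu - lam) * l (lam + e).
  by rewrite ltr_pM2l//; lra.
by have := ler_wpM2l (ltW e_gt0) h; lra.
Qed.

(* The tangent of [legendre L] at [x] is squeezed between the slopes attached
   to [x] and to the nearby point. *)
Let legendre_derive (x lam : R) : U x -> D lam -> subgradient L lam x ->
  ederivable (legendre L) x /\ ederive (legendre L) x = lam.
Proof.
move=> Ux Dl sl.
have fin t : U t -> legendre L t \is a fin_num.
  by move=> /subgradient_exists[nu Dn sn]; rewrite (legendreE Dn sn).
have [df <-] : derivable (fine \o legendre L) x 1 /\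
    derive1 (fine \o legendre L) x = lam.
  apply/derive_epsP => e e0.
  have [del del0 B] := subgradient_continuous Ux Dl sl e0.
  exists del => // t tx; have [Ut] := B t tx.
  have [nu Dn sn] := subgradient_exists Ut => /(_ nu Dn sn) nl.
  have := subgradient_legendre Dl sl t; have := subgradient_legendre Dn sn x.
  rewrite /= -(fineK (fin _ Ut)) -(fineK (fin _ Ux)) -!EFinD !lee_fin /=.
  set a := fine _; set b := fine _ => h1 h2.
  (* The remainder lies between 0 and (nu - lam) * (t - x). *)
  rewrite ger0_norm; last by lra.
  apply: (@le_trans _ _ ((nu - lam) * (t - x))); first by lra.
  by rewrite (le_trans (ler_norm _))// normrM ler_wpM2r.
split=> //; split=> //.
have := open_nbhs_nbhs (conj (open_interior (slopes L)) Ux).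
exact: filterS fin.
Qed.

Lemma ederivable_legendre (x : R) : U x -> ederivable (legendre L) x.
Proof.
by move=> Ux; have [lam Dl sl] := subgradient_exists Ux; case: (legendre_derive Ux Dl sl).
Qed.

Lemma legendre_fin (x : R) : U x -> legendre L x \is a fin_num.
Proof. by move=> /ederivable_legendre[/nbhs_singleton]. Qed.

Let ederive_legendreP (x : R) : U x -> D (ederive (legendre L) x) /\
  subgradient L (ederive (legendre L) x) x.
Proof.
move=> Ux; have [lam Dl sl] := subgradient_exists Ux.
by have [_ ->] := legendre_derive Ux Dl sl.
Qed.

Lemma ederive_legendre_continuous (x : R) : U x ->
  {for x, continuous (ederive (legendre L))}.
Proof.
move=> Ux; have [Dl sl] := ederive_legendreP Ux.
apply/cvgrPdist_le => e e0.
have [del del0 B] := subgradient_continuous Ux Dl sl e0.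
apply/nbhs_ballP; exists del => //= t; rewrite /ball_ /= distrC => tx.
have [Ut tB] := B t tx; have [Dt st] := ederive_legendreP Ut.
by rewrite distrC; exact: tB.
Qed.

Lemma subgradient_ederive_legendre (x : R) : ederivable (legendre L) x ->
  subgradient (legendre L) x (ederive (legendre L) x).
Proof.
move=> [/nbhs_singleton fx dx].
by apply: derivable_subgradient => //; exact: econvex_legendre.
Qed.

(* [y] ranges over all points of differentiability, not only over the slopes. *)
Lemma ederive_legendre_strict_mono (x y : R) : U x -> ederivable (legendre L) y ->
  y != x -> 0 < (ederive (legendre L) y - ederive (legendre L) x) * (y - x).
Proof.
move=> Ux dy yx; have [Dl sl] := ederive_legendreP Ux.
have fy : legendre L y \is a fin_num by case: dy => /nbhs_singleton.
have sy := subgradient_ederive_legendre dy.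
have sx := subgradient_legendre Dl sl.
set lam := ederive (legendre L) x in Dl sl sx *.
set s := ederive (legendre L) y in sy *.
have h1 := sx y; have h2 := sy x.
have fx := legendre_fin Ux.
move: h1 h2; rewrite -(fineK fx) -(fineK fy) -!EFinD !lee_fin => h1 h2.
rewrite lt_neqAle; apply/andP; split; last by lra.
apply/negP => /eqP /esym /eqP; rewrite mulf_eq0 !subr_eq0 (negbTE yx) orbF => /eqP sE.
rewrite sE in h2.
(* Equal derivatives at x and y make Fenchel-Young an equality at lam and y, so y is a second
   subgradient of L at lam. *)
apply: (no_kink Ux yx Dl sl) => t.
have := legendre_ge t y.
rewrite -(fineK fy).
have : fine (legendre L y) = fine (legendre L x) + lam * (y - x) by lra.
move=> ->; rewrite (legendreE Dl sl) /=.
case: (L t) (L_neqNy t) => [lt| |]// _; last by rewrite leey.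
rewrite (L_fin Dl) /= -!EFinD !lee_fin; lra.
Qed.

(** The bound [L_ge] says that mu is a subgradient of L at 0. *)
Lemma legendre_mean : U mu -> legendre L mu = 0%E /\ ederive (legendre L) mu = 0.
Proof.
move=> Um; have s0 : subgradient L 0 mu.
  by move=> t; rewrite L0 add0e subr0 mulrC.
have [_ ->] := legendre_derive Um D0 s0; split=> //.
by rewrite (legendreE D0 s0) /= L0 mul0r subr0.
Qed.

(** If the conjugate vanished at x, then x would be a subgradient of L at 0 besides mu. *)
Lemma legendre_gt0 (x : R) : U mu -> x != mu -> (0 < legendre L x)%E.
Proof.
move=> Um xmu; rewrite lt_neqAle legendre_ge0 andbT eq_sym; apply/eqP => lx0.
have s0 : subgradient L 0 mu.
  by move=> t; rewrite L0 add0e subr0 mulrC.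
apply: (no_kink Um xmu D0 s0) => t.
have := legendre_ge t x; rewrite lx0 L0 add0e subr0.
case: (L t) (L_neqNy t) => [lt| |]// _; last by rewrite leey.
by rewrite -EFinB !lee_fin; lra.
Qed.

End conjugate.

(** * The rate of a pair of designs *)

(** What the analysis of a pair uses of a conjugate. In [rf_derive_mono] the point y ranges over the
    whole line, because [rate] asks for a stationary point that is unique there. *)
Record rate_function_on {R : realType} (A : set R) (mu : R) (f : R -> \bar R) :
    Prop := RateFunctionOn {
  rf_derivable : forall x, A x -> ederivable f x;
  rf_derive_continuous : forall x, A x -> {for x, continuous (ederive f)};
  rf_subgradient : forall x, A x -> subgradient f x (ederive f x);
  rf_derive_mono : forall x y, A x -> ederivable f y -> y != x ->
    0 < (ederive f y - ederive f x) * (y - x);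
  rf_mean : f mu = 0%E;
  rf_derive_mean : ederive f mu = 0;
  rf_gt0 : forall x, x != mu -> (0 < f x)%E }.

(* On the segment joining the two means, [rate f1 f2 a b] is the minimum of
   [a * f1 + b * f2]; this also covers the convention for a = 0 or b = 0. *)
Section pair_of_rate_functions.
Context {R : realType} (f1 f2 : R -> \bar R) (mu1 mu2 : R).
Hypothesis mu12 : mu2 < mu1.
Hypothesis f1P : rate_function_on `[mu2, mu1] mu1 f1.
Hypothesis f2P : rate_function_on `[mu2, mu1] mu2 f2.

Let mu1I : `[mu2, mu1]%classic mu1.
Proof. by rewrite /= in_itv /= lexx ltW. Qed.

Let mu2I : `[mu2, mu1]%classic mu2.
Proof. by rewrite /= in_itv /= lexx ltW. Qed.

Let rf_fin mu f x : rate_function_on `[mu2, mu1] mu f -> `[mu2, mu1]%classic x ->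
  f x = (fine (f x))%:E.
Proof. by move=> fP /(rf_derivable fP)[/nbhs_singleton fx _]; rewrite fineK. Qed.

Let rf_ge0 mu f x : rate_function_on `[mu2, mu1] mu f -> 0 <= fine (f x).
Proof.
move=> fP; have [->|/(rf_gt0 fP)/ltW fx] := eqVneq x mu; last exact: fine_ge0.
by rewrite (rf_mean fP).
Qed.

(** The weighted sum of derivatives is negative at mu2 and positive at mu1, so it vanishes in
    between; strict monotonicity excludes a second zero. *)
Lemma stationary_unique (a b : R) : 0 < a -> 0 < b ->
  exists2 c, `[mu2, mu1]%classic c & unique (stationary f1 f2 a b) c.
Proof.
move=> a0 b0; pose h x := a * ederive f1 x + b * ederive f2 x.
have ch : {within `[mu2, mu1], continuous h}.
  apply: continuous_in_subspaceT => x; rewrite inE => xI.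
  by apply: cvgD; (apply: cvgM; first exact: cvg_cst);
    [exact: rf_derive_continuous f1P _ xI|exact: rf_derive_continuous f2P _ xI].
have d12 : 0 < mu1 - mu2 by rewrite subr_gt0.
have h1 : 0 < h mu1.
  have := rf_derive_mono f2P mu2I (rf_derivable f2P mu1I).
  rewrite (rf_derive_mean f2P) subr0 gt_eqF// => /(_ isT).
  by rewrite pmulr_lgt0// /h (rf_derive_mean f1P) mulr0 add0r; exact: mulr_gt0.
have h2 : h mu2 < 0.
  have := rf_derive_mono f1P mu1I (rf_derivable f1P mu2I).
  rewrite (rf_derive_mean f1P) subr0 lt_eqF// => /(_ isT).
  rewrite -opprB mulrN -mulNr pmulr_lgt0// oppr_gt0.
  by rewrite /h (rf_derive_mean f2P) mulr0 addr0 pmulr_rlt0.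
have [|c cI hc] := IVT (ltW mu12) ch (v := 0).
  by rewrite ge_min le_max (ltW h1) (ltW h2) orbT.
exists c => //; split; first split => //.
- exact: rf_derivable f1P _ cI.
- exact: rf_derivable f2P _ cI.
move=> y [d1 d2 hy]; apply/eqP/negPn/negP; rewrite eq_sym => yc.
have m1 := rf_derive_mono f1P cI d1 yc; have m2 := rf_derive_mono f2P cI d2 yc.
have : 0 < (h y - h c) * (y - c).
  have -> : (h y - h c) * (y - c) = a * ((ederive f1 y - ederive f1 c) * (y - c)) +
    b * ((ederive f2 y - ederive f2 c) * (y - c)) by rewrite /h; ring.
  by rewrite addr_gt0// mulr_gt0.
by rewrite hc /h hy subrr mul0r ltxx.
Qed.

Lemma rate_attained (a b : R) : 0 <= a -> 0 <= b -> exists2 c, `[mu2, mu1]%classic c &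
  rate f1 f2 a b = a * fine (f1 c) + b * fine (f2 c).
Proof.
rewrite /rate; have [-> _ _|a0 a_ge0] := eqVneq a 0.
  (* For a = 0 only f2 counts, and it vanishes at mu2; the case b = 0 uses mu1. *)
  by exists mu2 => //; rewrite (rf_mean f2P) /= mul0r mulr0 addr0.
have [-> _|b0 b_ge0] := eqVneq b 0.
  by exists mu1 => //; rewrite (rf_mean f1P) /= mul0r mulr0 addr0.
have [c cI uc] : exists2 c, `[mu2, mu1]%classic c & unique (stationary f1 f2 a b) c.
  by apply: stationary_unique; rewrite lt_neqAle eq_sym ?a0 ?b0.
exists c => //; rewrite (xget_unique 0 uc)// => y [sy _]; exact/esym/uc.2.
Qed.

(** Weighting the tangent inequalities at the stationary point by a and b cancels their linear
    terms. *)
Lemma rate_le (a b t : R) : 0 <= a -> 0 <= b -> `[mu2, mu1]%classic t ->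
  rate f1 f2 a b <= a * fine (f1 t) + b * fine (f2 t).
Proof.
move=> a_ge0 b_ge0 tI; rewrite /rate.
case: ifPn => [_|].
  by rewrite addr_ge0// mulr_ge0// ?(rf_ge0 _ f1P) ?(rf_ge0 _ f2P).
rewrite negb_or => /andP[a0 b0].
have [c cI uc] : exists2 c, `[mu2, mu1]%classic c & unique (stationary f1 f2 a b) c.
  by apply: stationary_unique; rewrite lt_neqAle eq_sym ?a0 ?b0.
rewrite (xget_unique 0 uc) => [|y [sy _]]; last exact/esym/uc.2.
have [_ _ st] := uc.1.
have := rf_subgradient f1P cI t; have := rf_subgradient f2P cI t.
rewrite (rf_fin f1P cI) (rf_fin f1P tI) (rf_fin f2P cI) (rf_fin f2P tI).
rewrite -!EFinD !lee_fin => h2 h1.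
have := ler_wpM2l a_ge0 h1; have := ler_wpM2l b_ge0 h2.
have : (a * ederive f1 c + b * ederive f2 c) * (t - c) = 0 by rewrite st mul0r.
lra.
Qed.

(** The means differ, so f1 and f2 have no common zero. *)
Lemma rate_gt0 (a b : R) : 0 < a -> 0 < b -> 0 < rate f1 f2 a b.
Proof.
move=> a0 b0; have [c cI ->] := rate_attained (ltW a0) (ltW b0).
have gt0 mu f : rate_function_on `[mu2, mu1] mu f -> c != mu -> 0 < fine (f c).
  by move=> fP /(rf_gt0 fP); rewrite (rf_fin fP cI) lte_fin.
have [->|c1] := eqVneq c mu1.
  rewrite (rf_mean f1P) /= mulr0 add0r mulr_gt0//.
  have : (0 < f2 mu1)%E by apply: (rf_gt0 f2P); rewrite gt_eqF.
  by rewrite (rf_fin f2P mu1I) lte_fin.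
have f1c := gt0 _ _ f1P c1.
have [c2|c2] := eqVneq c mu2.
  by rewrite {2}c2 (rf_mean f2P) /= mulr0 addr0 mulr_gt0.
by rewrite addr_gt0// mulr_gt0// (gt0 _ _ f2P).
Qed.

(** Homogeneity and monotonicity in one: compare both sides at the minimiser for (a', b'). *)
Lemma rate_scale (a b a' b' s : R) : 0 <= a -> 0 <= b -> 0 <= s ->
  s * a <= a' -> s * b <= b' -> s * rate f1 f2 a b <= rate f1 f2 a' b'.
Proof.
move=> a0 b0 s0 aa' bb'.
have a'0 : 0 <= a' by rewrite (le_trans _ aa')// mulr_ge0.
have b'0 : 0 <= b' by rewrite (le_trans _ bb')// mulr_ge0.
have [c cI ->] := rate_attained a'0 b'0.
apply: (le_trans (ler_wpM2l s0 (rate_le a0 b0 cI))).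
by rewrite mulrDr !mulrA lerD// ler_wpM2r// ?(rf_ge0 _ f1P) ?(rf_ge0 _ f2P).
Qed.

End pair_of_rate_functions.

Lemma rate_function_legendre (R : realType) (L : R -> \bar R) (mu : R) (A : set R) :
  L 0 = 0%E -> (eff_dom L)° 0 -> (forall t : R, ((t * mu)%:E <= L t)%E) ->
  econvex L -> strictly_convex_on (eff_dom L)° L ->
  (forall t : R, (eff_dom L)° t -> {for t, continuous L}) ->
  A `<=` (slopes L)° -> (slopes L)° mu ->
  rate_function_on A mu (legendre L).
Proof.
move=> L0 D0 L_ge L_cvx L_sc L_cont AU Um; split.
- move=> x /AU; exact: (@ederivable_legendre _ L mu).
- move=> x /AU; exact: (@ederive_legendre_continuous _ L mu).
- move=> x /AU Ux; apply: (@subgradient_ederive_legendre _ L mu) => //.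
  exact: (@ederivable_legendre _ L mu).
- move=> x y /AU; exact: (@ederive_legendre_strict_mono _ L mu).
- by have [] := @legendre_mean _ L mu L0 D0 L_ge L_cvx L_sc L_cont Um.
- by have [] := @legendre_mean _ L mu L0 D0 L_ge L_cvx L_sc L_cont Um.
- move=> x; exact: legendre_gt0.
Qed.

(** * Optimal allocations *)

(** The minimum serves as c'; starting it at [c + 1] covers an empty index set. *)
Lemma finite_strict_lower_bound (R : realType) (I : finType) (P : pred I)
    (F : I -> R) (c : R) : (forall i, P i -> c < F i) ->
  exists2 c', c < c' & forall i, P i -> c' <= F i.
Proof.
move=> cF; exists (\big[Num.min/c + 1]_(i | P i) F i).
  by apply/bigmin_gtP; split=> //; rewrite ltrDl.
by move=> i Pi; exact: bigmin_le_cond.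
Qed.

Section optimal_allocation.
Context {R : realType} (k m q : nat).
Variables (Ls : 'I_k -> 'I_q -> R -> \bar R) (sigma : 'I_q -> {perm 'I_k}).
Hypothesis m_ge1 : (1 <= m)%N.
Hypothesis m_lt_k : (m < k)%N.
Hypothesis rate_gt0 : forall (i j : 'I_k) l (a b : R), (i < m <= j)%N ->
  0 < a -> 0 < b -> 0 < rate (Ls (sigma l i) l) (Ls (sigma l j) l) a b.
Hypothesis rate_scale : forall (i j : 'I_k) l (a b a' b' s : R), (i < m <= j)%N ->
  0 <= a -> 0 <= b -> 0 <= s -> s * a <= a' -> s * b <= b' ->
  s * rate (Ls (sigma l i) l) (Ls (sigma l j) l) a b <=
  rate (Ls (sigma l i) l) (Ls (sigma l j) l) a' b'.

Variables (z : R) (r : 'I_k -> 'I_q -> R).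
Hypothesis r_optimal : optimal m Ls sigma z r.

(** There are finitely many rates, so r' would be feasible with some value above z. *)
Let optimal_not_improvable r' :
  \sum_(h < k) \sum_(l < q) r' (sigma l h) l = 1 ->
  (forall (h : 'I_k) l, 0 <= r' (sigma l h) l) ->
  ~ forall (i j : 'I_k) l, (i < m <= j)%N -> z < pair_rate Ls sigma r' l i j.
Proof.
move=> r'1 r'0 zlt.
have [t|z' zz' le] := @finite_strict_lower_bound R ('I_k * 'I_k * 'I_q)%type
    (fun t => (t.1.1 < m <= t.1.2)%N)
    (fun t => pair_rate Ls sigma r' t.2 t.1.1 t.1.2) z.
  exact: zlt.
suff : z' <= z by rewrite leNgt zz'.
apply: (r_optimal.2 z' r'); split=> // i j l ij.
by rewrite subr_ge0; exact: (le (i, j, l)).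
Qed.

Let r_ge0 h l : 0 <= r h l.
Proof.
have [[_ _ r0] _] := r_optimal.
by rewrite -[h](permKV (sigma l)); exact: r0.
Qed.

Let r_sum : \sum_(h < k) \sum_(l < q) r (sigma l h) l = 1.
Proof. by have [[]] := r_optimal. Qed.

Let pair_rate_ge (i j : 'I_k) l : (i < m <= j)%N -> z <= pair_rate Ls sigma r l i j.
Proof. by move=> ij; rewrite -subr_ge0; have [[+ _ _] _] := r_optimal; exact. Qed.

(** Otherwise the uniform allocation, whose rates are positive, would beat z. There is a context
    because an empty sum is not 1. *)
Lemma optimal_value_gt0 : 0 < z.
Proof.
rewrite ltNge; apply/negP => z0.
have q0 : (0 < q)%N.
  rewrite lt0n; apply/eqP => q0; have := r_sum.
  rewrite big1 => [/eqP|h _]; first by rewrite eq_sym oner_eq0.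
  by apply: big1 => -[l lq] _; exfalso; rewrite q0 in lq.
have kq0 : 0 < (k * q)%:R :> R by rewrite ltr0n muln_gt0 q0 (leq_ltn_trans _ m_lt_k).
apply: (@optimal_not_improvable (fun _ _ => (k * q)%:R^-1)).
- under eq_bigr do rewrite sumr_const card_ord.
  by rewrite sumr_const card_ord -mulrnA (mulnC q k) -[LHS]mulr_natl divff// gt_eqF.
- by move=> h l; rewrite invr_ge0 ltW.
- by move=> i j l ij; apply: le_lt_trans z0 _; apply: rate_gt0; rewrite ?invr_gt0.
Qed.

(** A zero share gives rate 0 < z with any design across the cut: rank m, the first below the cut,
    for a top design, and rank 0 for the others. *)
Lemma optimal_allocation_gt0 h l : 0 < r h l.
Proof.
have k0 : (0 < k)%N := leq_ltn_trans (leq0n m) m_lt_k.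
suff rg g : 0 < r (sigma l g) l by rewrite -[h](permKV (sigma l)).
rewrite lt_neqAle r_ge0 andbT eq_sym; apply/eqP => r0.
have [gm|mg] := ltnP g m.
  have ij : (g < m <= Ordinal m_lt_k)%N by rewrite gm /=.
  have := pair_rate_ge l ij.
  by rewrite /pair_rate /rate r0 eqxx leNgt optimal_value_gt0.
have ij : (Ordinal k0 < m <= g)%N by rewrite mg /= m_ge1.
have := pair_rate_ge l ij.
by rewrite /pair_rate /rate r0 eqxx orbT leNgt optimal_value_gt0.
Qed.

(* Otherwise shrink the share of this design and scale the whole allocation
   back up to total 1: all rates would exceed z. *)
Lemma optimal_binding g l0 : exists i j : 'I_k,
  [/\ (i < m <= j)%N, (i == g) || (j == g) & pair_rate Ls sigma r l0 i j <= z].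
Proof.
apply: contrapT => nobind; have z0 := optimal_value_gt0.
have [t /andP[ij tg]|w zw le] := @finite_strict_lower_bound R ('I_k * 'I_k)%type
    (fun t => (t.1 < m <= t.2)%N && ((t.1 == g) || (t.2 == g)))
    (fun t => pair_rate Ls sigma r l0 t.1 t.2) z.
  rewrite ltNge; apply/negP => rz; apply: nobind.
  by exists t.1, t.2.
have w0 : 0 < w by exact: lt_trans zw.
(* Chosen so that (1 - e) * w is the midpoint of z and w. *)
pose e := (w - z) / (2 * w).
have e0 : 0 < e by rewrite divr_gt0 ?subr_gt0 ?mulr_gt0.
have e1 : e < 1 by rewrite ltr_pdivrMr ?mulr_gt0//; lra.
have ew : z < (1 - e) * w.
  have -> : (1 - e) * w = (w + z) / 2 by rewrite /e; field; rewrite gt_eqF.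
  lra.
set r0 := r (sigma l0 g) l0.
have r0_gt0 : 0 < r0 by exact: optimal_allocation_gt0.
have r0_le1 : r0 <= 1.
  rewrite -r_sum (bigD1 g)//= (bigD1 l0)//= -addrA lerDl addr_ge0// ?sumr_ge0// => *.
  exact: sumr_ge0.
have er0 : 0 < e * r0 by rewrite mulr_gt0.
have er1 : e * r0 < 1 by rewrite (le_lt_trans _ e1)// ler_piMr// ltW.
(* The shrunken allocation has total 1 - e * r0. *)
pose s := (1 - e * r0)^-1.
have s1 : 1 < s by rewrite invf_gt1 ?subr_gt0//; lra.
have s0 : 0 < s by exact: lt_trans s1.
pose hit h l := (h == sigma l0 g) && (l == l0).
pose r' h l := s * (if hit h l then (1 - e) * r h l else r h l).
have hitE h l : hit (sigma l h) l = (h == g) && (l == l0).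
  by rewrite /hit; have [->|_] := eqVneq l l0; rewrite ?andbF// !andbT (inj_eq perm_inj).
apply: (@optimal_not_improvable r').
- rewrite /r'; under eq_bigr do rewrite -mulr_sumr.
  rewrite -mulr_sumr.
  suff -> : \sum_(h < k) \sum_(l < q) (if hit (sigma l h) l then
      (1 - e) * r (sigma l h) l else r (sigma l h) l) = 1 - e * r0.
    by rewrite mulVf// gt_eqF// subr_gt0.
  have := r_sum; rewrite !pair_big /= !(bigD1 (P := predT) (g, l0))//= hitE !eqxx /=.
  rewrite -/r0 [X in _ -> _ + X = _](eq_bigr (fun p => r (sigma p.2 p.1) p.2)).
    by lra.
  by move=> [h l] /= hl; rewrite hitE -[_ && _]/((h, l) == (g, l0)) (negbTE hl).
- move=> h l; rewrite /r' mulr_ge0 ?(ltW s0)//; case: ifP => // _.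
  by rewrite mulr_ge0// subr_ge0 ltW.
- move=> i j l ij.
  have r'_ge t h' l' : t <= 1 - e -> s * t * r h' l' <= r' h' l'.
    move=> te; rewrite -mulrA /r' ler_pM2l//; case: ifP => _.
      by rewrite ler_wpM2r.
    by rewrite ler_piMl//; lra.
  (* Rates involving the shrunken pair are at least s * (1 - e) * w > z; the others are at least s *
     z, which exceeds z because z > 0. *)
  have [hitij|nohit] := boolP (((i == g) || (j == g)) && (l == l0)).
    have e1' : 0 <= 1 - e by rewrite subr_ge0 ltW.
    move: hitij => /andP[gij /eqP ll0]; rewrite ll0.
    apply: (@lt_le_trans _ _ (s * (1 - e) * pair_rate Ls sigma r l0 i j)).
      apply: (lt_le_trans ew); rewrite -mulrA.
      have le1 : (1 - e) * w <= (1 - e) * pair_rate Ls sigma r l0 i j.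
        rewrite ler_pM2l ?subr_gt0//; apply: (le (i, j)) => /=.
        by rewrite ij gij.
      apply: (le_trans le1); rewrite ler_peMl ?(ltW s1)//.
      by apply: le_trans le1; rewrite mulr_ge0// ltW.
    apply: rate_scale => //; [exact: mulr_ge0 (ltW s0) _|exact: r'_ge|exact: r'_ge].
  have r'E h : (h == i) || (h == j) -> r' (sigma l h) l = s * r (sigma l h) l.
    rewrite /r' hitE; case: ifP => // /andP[/eqP -> /eqP ll0]; move: nohit.
    by rewrite ll0 eqxx andbT ![_ == g]eq_sym => /negbTE ->.
  apply: (@lt_le_trans _ _ (s * pair_rate Ls sigma r l i j)).
    apply: (lt_le_trans (y := s * z)); first by rewrite ltr_pMl.
    by rewrite ler_pM2l//; exact: pair_rate_ge.
  by apply: rate_scale => //; rewrite ?(ltW s0)// r'E ?eqxx ?orbT.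
Qed.

(** Feasibility gives the lower bound. A binding pair containing i attains it, and i < m forces i to
    be its first member. *)
Lemma optimal_min_over_j l (i : 'I_k) : (i < m)%N ->
  min_over_j m Ls sigma r l i = z%:E.
Proof.
move=> im; apply/eqP; rewrite eq_le; apply/andP; split.
  have [i' [j [/andP[i'm mj] /orP[/eqP -> rz|/eqP jg]]]] := optimal_binding i l.
    by apply: (@bigmin_inf _ _ _ _ j) => //; rewrite lee_fin.
  by move: mj; rewrite jg leqNgt im.
apply/bigmin_geP; split; first exact: leey.
by move=> j mj; rewrite lee_fin pair_rate_ge// im.
Qed.

Lemma optimal_min_over_i l (j : 'I_k) : (m <= j)%N ->
  min_over_i m Ls sigma r l j = z%:E.
Proof.
move=> mj; apply/eqP; rewrite eq_le; apply/andP; split.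
  have [i [j' [/andP[im mj'] /orP[/eqP ig|/eqP -> rz]]]] := optimal_binding j l.
    by move: im; rewrite ig ltnNge mj.
  by apply: (@bigmin_inf _ _ _ _ i) => //; rewrite lee_fin.
apply/bigmin_geP; split; first exact: leey.
by move=> i im; rewrite lee_fin pair_rate_ge// im.
Qed.

End optimal_allocation.

Theorem lemma1 (R : realType) (d : measure_display) (T : measurableType d)
  (P : probability T R) (k m q : nat) (m_ge1 : (1 <= m)%N) (m_lt_k : (m < k)%N)
  (X : Type) (x : 'I_q -> X) (y : 'I_k -> X -> R)
  (Y : 'I_k -> 'I_q -> nat -> {RV P >-> R})
  (Y_iid : iid_replications Y (fun h l => y h (x l)))
  (sigma : 'I_q -> {perm 'I_k})
  (sigma_ranking : ranking m (fun h l => y h (x l)) sigma)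
  (* Assumption 1 *)
  (Lam_defined : forall h l lam, cvgn (scaled_log_mgf (Y h l) lam))
  (zero_int : forall h l, (eff_dom (Lam (Y h l)))° 0)
  (* Assumption 2 *)
  (Lam_strictly_convex : forall h l,
     strictly_convex_on (eff_dom (Lam (Y h l)))° (Lam (Y h l)))
  (Lam_continuous : forall h l (lam : R), (eff_dom (Lam (Y h l)))° lam ->
     {for lam, continuous (Lam (Y h l))})
  (Lam_steep : forall h l, steep (Lam (Y h l)))
  (* Assumption 3 *)
  (means_in_slopes : forall (l : 'I_q) (first last : 'I_k),
     first = 0%N :> nat -> last = k.-1 :> nat ->
     `[y (sigma l last) (x l), y (sigma l first) (x l)] `<=`
     \bigcap_(i in [set: 'I_k]) (slopes (Lam (Y i l)))°)
  (z : R) (r : 'I_k -> 'I_q -> R)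
  (r_optimal : optimal m (fun h l => legendre (Lam (Y h l))) sigma z r) :
  let Ls := fun h l => legendre (Lam (Y h l)) in
  (forall h l, 0 < r h l) /\
  (forall (i j' : 'I_k) (l l' : 'I_q), (i < m)%N -> (m <= j')%N ->
     [/\ min_over_j m Ls sigma r l i = min_over_i m Ls sigma r l j',
         min_over_i m Ls sigma r l j' = min_over_j m Ls sigma r l' i
       & min_over_j m Ls sigma r l' i = min_over_i m Ls sigma r l' j']).
Proof.
move=> Ls.
have [_ _ EY] := Y_iid.
have k0 : (0 < k)%N := leq_ltn_trans (leq0n m) m_lt_k.
have rf h l A : A `<=` (slopes (Lam (Y h l)))° ->
    (slopes (Lam (Y h l)))° (y h (x l)) -> rate_function_on A (y h (x l)) (Ls h l).
  have YE s : 'E_P[Y h l s]%E = (y h (x l))%:E := EY h l s.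
  apply: rate_function_legendre => //.
  - exact: Lam0.
  - move=> t; exact: Lam_ge_mean (YE) _ (Lam_defined h l t).
  - by move=> s t p; apply: Lam_convex YE _ s t p.
  - exact: Lam_continuous.
(* Any t between two means of context l lies between those of ranks 0 and k - 1, where Assumption 3
   covers every design h. *)
have range_slopes l (h : 'I_k) t (i j : 'I_k) :
    y (sigma l j) (x l) <= t <= y (sigma l i) (x l) ->
    (slopes (Lam (Y h l)))° t.
  move=> /andP[jt ti]; have kp : (k.-1 < k)%N by rewrite prednK.
  apply: (means_in_slopes l (Ordinal k0) (Ordinal kp)) => //=.
  rewrite in_itv /=; apply/andP; split.
    apply: le_trans jt; apply: (sigma_ranking l j (Ordinal kp)).1 => /=.
    by rewrite -ltnS prednK.
  by apply: (le_trans ti); apply: (sigma_ranking l (Ordinal k0) i).1.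
have pairP (i j : 'I_k) l : (i < m <= j)%N ->
    let mu1 := y (sigma l i) (x l) in let mu2 := y (sigma l j) (x l) in
    [/\ mu2 < mu1, rate_function_on `[mu2, mu1] mu1 (Ls (sigma l i) l)
      & rate_function_on `[mu2, mu1] mu2 (Ls (sigma l j) l)].
  move=> ij mu1 mu2; have mu12 : mu2 < mu1 by exact: (sigma_ranking l i j).2.
  have sub h : `[mu2, mu1] `<=` (slopes (Lam (Y h l)))°.
    by move=> t; rewrite /= in_itv /=; exact: range_slopes.
  split=> //; apply: rf => //; apply: (range_slopes l _ _ i j); rewrite ?lexx ltW//.
have gt0 (i j : 'I_k) l (a b : R) : (i < m <= j)%N -> 0 < a -> 0 < b ->
    0 < rate (Ls (sigma l i) l) (Ls (sigma l j) l) a b.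
  by move=> /(pairP _ _ l)[mu12 f1P f2P]; exact: (rate_gt0 mu12 f1P f2P).
have sc (i j : 'I_k) l (a b a' b' s : R) : (i < m <= j)%N ->
    0 <= a -> 0 <= b -> 0 <= s -> s * a <= a' -> s * b <= b' ->
    s * rate (Ls (sigma l i) l) (Ls (sigma l j) l) a b <=
    rate (Ls (sigma l i) l) (Ls (sigma l j) l) a' b'.
  by move=> /(pairP _ _ l)[mu12 f1P f2P]; exact: (rate_scale mu12 f1P f2P).
split=> [h l|i j' l l' im mj].
  exact: (optimal_allocation_gt0 m_ge1 m_lt_k gt0 r_optimal).
have minj := optimal_min_over_j m_ge1 m_lt_k gt0 sc r_optimal.
have mini := optimal_min_over_i m_ge1 m_lt_k gt0 sc r_optimal.
by rewrite !minj// !mini.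
Qed.
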